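(* Let $\mathcal{H}$ and $\mathcal{G}$ be real Hilbert spaces, let $L\colon\mathcal{H}\to\mathcal{G}$ be a bounded linear operator with $\|L\|\leq 1$, let $B\colon\mathcal{G}\to 2^{\mathcal{G}}$ be monotone, and let $\gamma\in(0,+\infty)$. Then the following hold: (i) $L\overset{\gamma}{\diamond}B$ and $L\overset{\gamma}{\bullet}B$ are monotone. (ii) Suppose that $B$ is maximally monotone. Then $L\overset{\gamma}{\diamond}B$ and $L\overset{\gamma}{\bullet}B$ are maximally monotone.
   Context: A set-valued operator $A\colon\mathcal{H}\to2^{\mathcal{H}}$ is monotone if $\langle x_1-x_2\mid x_1^*-x_2^*\rangle\geq 0$ whenever $x_1^*\in Ax_1$ and $x_2^*\in Ax_2$, and maximally monotone if it is monotone and its graph is not properly contained in the graph of another monotone operator. $A^{-1}$ is defined by $x\in A^{-1}x^*\Leftrightarrow x^*\in Ax$. Sums, scalar multiples and compositions are pointwise, e.g. $(L^*\circ C\circ L)x=\{L^*y\mid y\in C(Lx)\}$. For a bounded linear $L\colon\mathcal{H}\to\mathcal{G}$ with adjoint $L^*$ and $C\colon\mathcal{G}\to2^{\mathcal{G}}$, the parallel composition is $L^*\triangleright C=(L^*\circ C^{-1}\circ L)^{-1}\colon\mathcal{H}\to2^{\mathcal{H}}$. For $\gamma>0$, the resolvent composition is $L\overset{\gamma}{\diamond}C=L^*\triangleright(C+\gamma^{-1}\mathrm{Id}_{\mathcal{G}})-\gamma^{-1}\mathrm{Id}_{\mathcal{H}}\colon\mathcal{H}\to2^{\mathcal{H}}$,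 and the resolvent cocomposition is $L\overset{\gamma}{\bullet}C=(L\overset{1/\gamma}{\diamond}C^{-1})^{-1}\colon\mathcal{H}\to2^{\mathcal{H}}$. *)

(* Defs.v *)
From HB Require Import structures.
From mathcomp Require Import all_boot all_order all_algebra.
From mathcomp Require Import all_classical all_reals all_analysis.

Set Implicit Arguments.
Unset Strict Implicit.
Unset Printing Implicit Defensive.

Import Order.TTheory GRing.Theory Num.Theory.
Import numFieldNormedType.Exports.

Local Open Scope classical_set_scope.
Local Open Scope ring_scope.

(* A real Hilbert space is a Banach space whose norm comes from a scalar
   product; [{dot H for idfun}] is the type of symmetric positive definite
   bilinear forms on [H]. *)
HB.mixin Record CompleteNormedModule_isHilbert (R : realType) H
    of CompleteNormedModule R H := {
  inner : {dot H for idfun};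
  inner_norm : forall x : H, inner x x = `|x| ^+ 2
}.

#[short(type="hilbertType")]
HB.structure Definition Hilbert (R : realType) :=
  {H of CompleteNormedModule R H & CompleteNormedModule_isHilbert R H}.

Section linear_operators.
Context {R : realType} {H G : hilbertType R}.
Implicit Type L : {linear H -> G}.

Definition bounded_operator L := bounded_near L (nbhs (0 : H)).

(* [sup] is a junk value when the set is unbounded, so [opnorm L] is only
   meaningful when [L] is bounded. *)
Definition opnorm L : R := sup [set `|L x| | x in [set x : H | `|x| <= 1]].

(* For bounded [L], the Riesz representation theorem yields exactly one such
   [z]; the default value 0 is then never used. *)
Definition adjoint L (y : G) : H :=
  xget 0 [set z : H | forall x : H, inner (L x) y = inner x z].

End linear_operators.

Section set_valued_operators.
Context {R : realType}.
Implicit Types H G : hilbertType R.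

Definition op_graph H (A : H -> set H) : set (H * H) := [set p | A p.1 p.2].

Definition monotone_op H (A : H -> set H) : Prop :=
  forall x1 x2 u1 u2 : H, A x1 u1 -> A x2 u2 -> 0 <= inner (x1 - x2) (u1 - u2).

Definition maximally_monotone_op H (A : H -> set H) : Prop :=
  monotone_op A /\
  ~ exists A' : H -> set H, monotone_op A' /\ op_graph A `<` op_graph A'.

Definition op_inv H (A : H -> set H) : H -> set H :=
  fun u => [set x | A x u].

Definition op_id H : H -> set H := fun x => [set x].

Definition op_scale H (c : R) (A : H -> set H) : H -> set H :=
  fun x => [set c *: u | u in A x].

Definition op_add H (A1 A2 : H -> set H) : H -> set H :=
  fun x => [set u + v | u in A1 x & v in A2 x].

Definition op_sub H (A1 A2 : H -> set H) : H -> set H :=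
  fun x => [set u - v | u in A1 x & v in A2 x].

Definition conjugate_by_adjoint H G (L : {linear H -> G}) (C : G -> set G) :
    H -> set H :=
  fun x => [set adjoint L y | y in C (L x)].

Definition parallel_composition H G (L : {linear H -> G}) (C : G -> set G) :
    H -> set H :=
  op_inv (conjugate_by_adjoint L (op_inv C)).

Definition resolvent_composition H G (L : {linear H -> G}) (gamma : R)
    (C : G -> set G) : H -> set H :=
  op_sub
    (parallel_composition L (op_add C (op_scale gamma^-1 (@op_id G))))
    (op_scale gamma^-1 (@op_id H)).

Definition resolvent_cocomposition H G (L : {linear H -> G}) (gamma : R)
    (C : G -> set G) : H -> set H :=
  op_inv (resolvent_composition L (1 / gamma) (op_inv C)).

End set_valued_operators.

(* Main.v *)
Require Import Defs.
From HB Require Import structures.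
From mathcomp Require Import all_boot all_order all_algebra.
From mathcomp Require Import all_classical all_reals all_analysis.
From mathcomp Require Import ring lra.
Import Order.TTheory GRing.Theory Num.Theory.
Import numFieldNormedType.Exports.
Local Open Scope classical_set_scope.
Local Open Scope ring_scope.

(* Unfolding the definitions, u is in (L <> B) x exactly when x = L^* y and
   L (u + x / gamma) - y / gamma is in B y for some y.  Monotonicity then follows
   from that of B and |L^* y| <= |y|.  If B is maximally monotone, Minty's theorem
   makes B + Id / gamma surjective, hence so is L <> B + Id / gamma, and this
   forces maximality; the cocomposition follows by taking inverses.
   The surjectivity part of Minty's theorem is obtained from the minimizer (x, u)
   of F + |.|^2 / 2, where F is the Fitzpatrick function of the operator A:
   optimality tested on the graph of A shows that (-u, -x) is monotonically
   related to that graph and that x = -u.  The same minimization principle,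
   applied to minus a bounded linear form, gives the Riesz representation
   theorem and thus the adjoint. *)

(** * Scalar product: bilinearity, Cauchy-Schwarz inequality, continuity *)

Section inner_product.
Context {R : realType} {H : hilbertType R}.
Implicit Types (x y z : H) (a : R).

Lemma innerC x y : inner x y = inner y x.
Proof. by rewrite (hermC inner) /= expr0 mul1r. Qed.

Lemma innerDl x y z : inner (x + y) z = inner x z + inner y z.
Proof. exact: linearDl. Qed.

Lemma innerDr x y z : inner x (y + z) = inner x y + inner x z.
Proof. exact: linearDr. Qed.

Lemma innerNl x y : inner (- x) y = - inner x y.
Proof. exact: linearNl. Qed.

Lemma innerNr x y : inner x (- y) = - inner x y.
Proof. exact: linearNr. Qed.

Lemma inner0l y : inner 0 y = 0.
Proof. exact: linear0l. Qed.

Lemma innerZl a x y : inner (a *: x) y = a * inner x y.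
Proof. exact: linearZl_LR. Qed.

Lemma innerZr a x y : inner x (a *: y) = a * inner x y.
Proof. exact: linearZr_LR. Qed.

Definition innerE := (innerDl, innerDr, innerNl, innerNr, innerZl, innerZr).

Lemma inner_ge0 x : 0 <= inner x x.
Proof. by rewrite inner_norm exprn_ge0. Qed.

Lemma inner_eq0 x : inner x x <= 0 -> x = 0.
Proof.
rewrite inner_norm => x0; apply/eqP.
by rewrite -normr_eq0 -sqrf_eq0 eq_le x0 exprn_ge0.
Qed.

(** Reduces [inner] to the norm: the triangle inequality then gives Cauchy-Schwarz, and continuity
    of the norm gives [cvg_inner]. *)
Lemma polarization x y : inner x y = (`|x + y| ^+ 2 - `|x| ^+ 2 - `|y| ^+ 2) / 2.
Proof. by rewrite -!inner_norm !innerE (innerC y x); lra. Qed.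

Lemma Cauchy_Schwarz x y : inner x y <= `|x| * `|y|.
Proof.
rewrite polarization.
have := ler_normD x y; have := normr_ge0 (x + y).
by move: `|x + y| `|x| `|y| => a b d; nra.
Qed.

Lemma cvg_inner (T : Type) (F : set_system T) {FF : Filter F} (f g : T -> H) x y :
  f @ F --> x -> g @ F --> y -> inner (f t) (g t) @[t --> F] --> inner x y.
Proof.
move=> fx gy; rewrite polarization.
under eq_fun do rewrite polarization.
apply: cvgM; last exact: cvg_cst.
by apply: cvgB; [apply: cvgB|]; rewrite expr2; under eq_fun do rewrite expr2;
  apply: cvgM; apply: cvg_norm => //; apply: cvgD.
Qed.

End inner_product.

(** * Quadratic minimization over convex sets and Riesz representation *)

Lemma cvgn_sq_dist (R : realType) (V : completeNormedModType R) (u : V ^nat) (c : R) :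
  (forall n k, `|u n - u k| ^+ 2 <= c * (n.+1%:R^-1 + k.+1%:R^-1)) -> cvgn u.
Proof.
move=> uc; apply/cauchy_cvgP/cauchy_ballP => e e0.
have h : \forall n \near \oo, c * n.+1%:R^-1 < e ^+ 2 / 2.
  have : (c * n.+1%:R^-1) @[n --> \oo] --> c * 0.
    by apply: cvgM; [exact: cvg_cst|exact: cvg_harmonic].
  rewrite mulr0 => /cvgr_lt; apply.
  by rewrite divr_gt0// exprn_gt0.
rewrite near_map2 -ball_normE; near=> n k => /=.
have h1 : c * n.+1%:R^-1 < e ^+ 2 / 2 by near: n.
have h2 : c * k.+1%:R^-1 < e ^+ 2 / 2 by near: k.
rewrite -(@ltr_pXn2r _ 2)// ?nnegrE ?(ltW e0)//.
by apply: le_lt_trans (uc _ _) _; rewrite mulrDr [ltRHS]splitr ltrD.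
Unshelve. all: by end_near.
Qed.

Section minimization.
Context {R : realType} {H G : hilbertType R}.
Implicit Types (S : set (H * G * R)) (z p : H * G * R).

Let energy z := z.2 + (inner z.1.1 z.1.1 + inner z.1.2 z.1.2) / 2.

(* [S] plays the role of the epigraph of a proper lower semicontinuous convex
   function [F] on [H * G], with the Hilbertian norm
   rather than the library's max norm; the minimizer of
   [F + |.|^2 / 2] satisfies the stated variational inequality. *)
Lemma convex_minimization S (m : R) : closed S -> S !=set0 ->
  (forall z p (s : R), 0 <= s -> s <= 1 -> S z -> S p -> S (z + s *: (p - z))) ->
  (forall z, S z -> m <= z.2 + (inner z.1.1 z.1.1 + inner z.1.2 z.1.2) / 2) ->
  exists2 z, S z & forall p, S p ->
    z.2 + inner z.1.1 z.1.1 + inner z.1.2 z.1.2 <=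
    p.2 + inner z.1.1 p.1.1 + inner z.1.2 p.1.2.
Proof.
move=> Sclosed [w Sw] Sconv Sm.
pose E := energy @` S; pose i := inf E.
have hE : has_inf E.
  split; first by exists (energy w), w.
  by exists m => _ [z Sz <-]; exact: Sm.
have ilb z : S z -> i <= energy z.
  by move=> Sz; apply: ge_inf; [exact: hE.2|exists z].
have /choice[u Su] : forall n : nat, exists z, S z /\ energy z < i + n.+1%:R^-1.
  move=> n; have n0 : 0 < n.+1%:R^-1 :> R by rewrite invr_gt0.
  by have [_ [z Sz <-] zi] := inf_adherent n0 hE; exists z.
(* The midpoint of [u n] and [u k] lies in [S], so its energy is at least [i]; the parallelogram law
   turns this into a bound by the optimality gaps. *)
have hdist n k :
  inner ((u n).1.1 - (u k).1.1) ((u n).1.1 - (u k).1.1) +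
  inner ((u n).1.2 - (u k).1.2) ((u n).1.2 - (u k).1.2) <=
    4 * (n.+1%:R^-1 + k.+1%:R^-1).
  have [Sn en] := Su n; have [Sk ek] := Su k.
  have h2 : (0 <= 1 / 2 :> R) /\ (1 / 2 <= 1 :> R) by split; lra.
  have /ilb := Sconv _ _ _ h2.1 h2.2 Sn Sk.
  move: en ek; rewrite /energy /= !innerE !(innerC (u k).1.1 (u n).1.1)
    !(innerC (u k).1.2 (u n).1.2) /GRing.scale /=.
  by move: (n.+1%:R^-1) (k.+1%:R^-1) => a b; lra.
have cx : cvgn (fun n => (u n).1.1).
  apply: (@cvgn_sq_dist _ _ _ 4) => n k; rewrite -inner_norm.
  by apply: le_trans (hdist n k); rewrite lerDl inner_ge0.
have cy : cvgn (fun n => (u n).1.2).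
  apply: (@cvgn_sq_dist _ _ _ 4) => n k; rewrite -inner_norm.
  by apply: le_trans (hdist n k); rewrite lerDr inner_ge0.
set x := limn (fun n => (u n).1.1) in cx.
set y := limn (fun n => (u n).1.2) in cy.
(* The limit of the last coordinate is forced: energies tend to [i] and the quadratic part
   converges. *)
pose t := i - (inner x x + inner y y) / 2.
have ce : energy (u n) @[n --> \oo] --> i.
  apply: (@squeeze_cvgr _ _ _ _ (cst i) (fun n => i + n.+1%:R^-1)).
  - by apply: nearW => n /=; have [Sn /ltW ->] := Su n; rewrite ilb.
  - exact: cvg_cst.
  - rewrite -[X in _ --> X]addr0; apply: cvgD; first exact: cvg_cst.
    exact: cvg_harmonic.
have ct : (u n).2 @[n --> \oo] --> t.
  have -> : (fun n => (u n).2) = (fun n => energy (u n) -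
      (inner (u n).1.1 (u n).1.1 + inner (u n).1.2 (u n).1.2) / 2).
    by apply/funext => n; rewrite /energy addrK.
  apply: cvgB => //; apply: cvgM; last exact: cvg_cst.
  by apply: cvgD; apply: cvg_inner.
have Sz : S ((x, y), t).
  apply: (@closed_cvg _ _ \oo _ (fun n => ((u n).1.1, (u n).1.2, (u n).2))) => //.
    by apply: nearW => n; have [] := Su n; case: (u n) => -[].
  exact: (cvg_pair (cvg_pair cx cy) ct).
have ez : energy ((x, y), t) = i by rewrite /energy /t /= subrK.
exists ((x, y), t) => // p Sp /=.
set q := inner (p.1.1 - x) (p.1.1 - x) + inner (p.1.2 - y) (p.1.2 - y).
have q0 : 0 <= q by rewrite addr_ge0 ?inner_ge0.
(* Minimality at the point [z + s *: (p - z)] of the segment, divided by [s]; the error term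
   vanishes as [s] tends to 0. *)
have key (s : R) : 0 < s -> s <= 1 ->
    t + inner x x + inner y y <= p.2 + inner x p.1.1 + inner y p.1.2 + s * (q / 2).
  move=> s0 s1; have /ilb := Sconv _ _ _ (ltW s0) s1 Sz Sp.
  rewrite -ez /energy /q /= !innerE (innerC p.1.1 x) (innerC p.1.2 y) /GRing.scale /=.
  move=> h; rewrite -(ler_pM2l s0); lra.
apply/ler_addgt0Pr => e e0.
pose s := Num.min 1 (e / (q + 1)).
have s0 : 0 < s by rewrite lt_min ltr01 divr_gt0// ltr_wpDl.
apply: le_trans (key s s0 _) _; first by rewrite ge_min lexx.
rewrite lerD2l.
have : s * (q + 1) <= e by rewrite -ler_pdivlMr ?ltr_wpDl// ge_min lexx orbT.
by nra.
Qed.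

End minimization.

(** The representative minimizes [|x|^2 / 2 - f x]: optimality tested at [z + h] and [z - h] gives
    both inequalities between [f h] and [inner h z]. *)
Lemma riesz_representation (R : realType) (H : hilbertType R) (f : H -> R) (c : R) :
  scalar f -> (forall x, f x <= c * `|x|) ->
  exists z, forall x, f x = inner x z.
Proof.
move=> flin fc.
have fD x y : f (x + y) = f x + f y.
  by have := flin 1 x y; rewrite scale1r mul1r.
have f0 : f 0 = 0 by have := fD 0 0; rewrite addr0; lra.
have fZ a x : f (a *: x) = a * f x by have := flin a x 0; rewrite !addr0 f0 addr0.
have fN x : f (- x) = - f x by rewrite -scaleN1r fZ mulN1r.
have fcont : continuous f.
  move=> x; apply/(@cvgrPdist_lt _ R^o) => e e0.
  (* The one-sided bound, used at [x - y] and [y - x], makes [f] Lipschitz; this constant is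
     positive whatever the sign of [c]. *)
  have k0 : 0 < `|c| + 1 by rewrite ltr_wpDl.
  near=> y.
  have : (`|c| + 1) * `|x - y| < e.
    rewrite mulrC -ltr_pdivlMr//; near: y.
    by apply: (@cvgr_dist_lt _ _ _ _ _ id) => //; rewrite divr_gt0.
  apply: le_lt_trans; rewrite ler_norml.
  have h y' : f y' <= (`|c| + 1) * `|y'|.
    by apply: le_trans (fc _) _; rewrite ler_wpM2r// ler_wpDr// ler_norm.
  by have := h (x - y); have := h (y - x); rewrite distrC !fD !fN; lra.
(* The second factor [H] is inert here. *)
pose S : set (H * H * R) := [set p | p.2 + f p.1.1 = 0].
(* The lower bound comes from completing the square in [|x|^2 / 2 - c * |x|]. *)
have [|||p Sp|[[z w] t] /= Sz zmin] := @convex_minimization _ _ _ S (- (c ^+ 2) / 2).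
- apply: (@closed_comp _ _ (fun p : H * H * R => p.2 + f p.1.1) [set 0]).
    move=> p _; apply: cvgD; first exact: cvg_snd.
    apply: continuous_cvg; first exact: fcont.
    by apply: (cvg_comp _ _ cvg_fst); exact: cvg_fst.
  exact: closed_eq.
- by exists (0, 0, 0); rewrite /S /= f0 addr0.
- move=> p q s _ _; rewrite /S /= => Sp Sq; rewrite fD fZ fD fN /GRing.scale /=.
  by rewrite addrACA Sp -mulrDr add0r addrACA Sq -opprD Sp subrr mulr0.
- rewrite [inner p.1.1 _]inner_norm.
  have := fc p.1.1; have := inner_ge0 p.1.2; have := sqr_ge0 (c - `|p.1.1|).
  rewrite (_ : p.2 = - f p.1.1); last by apply/eqP; rewrite -addr_eq0 Sp.
  by move: (inner p.1.2 _) (f p.1.1) `|p.1.1| => a b d; nra.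
exists z => x.
have key h : f h <= inner h z.
  have := zmin (z + h, w, - f (z + h)); rewrite /S /= addNr fD innerDr (innerC z h).
  by move=> /(_ erefl); rewrite /S /= in Sz; lra.
by apply/eqP; rewrite eq_le key /=; have := key (- x); rewrite fN innerNl; lra.
Unshelve. all: by end_near.
Qed.

(** * Adjoint and norm of a bounded operator *)

Section adjoint.
Context {R : realType} {H G : hilbertType R}.
Implicit Type L : {linear H -> G}.

(** By Cauchy-Schwarz the form [inner (L x) y] is bounded in [x], so Riesz provides a witness for
    [xget]. *)
Lemma inner_adjoint L (c : R) : (forall x, `|L x| <= c * `|x|) ->
  forall x y, inner (L x) y = inner x (adjoint L y).
Proof.
move=> Lc x y; rewrite /adjoint; move: x.
apply: (@xgetPex _ 0 [set z : H | forall x : H, inner (L x) y = inner x z]).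
apply: (@riesz_representation _ _ _ (c * `|y|)) => [a x x'|x].
  by rewrite linearP !innerE.
apply: le_trans (Cauchy_Schwarz _ _) _.
by rewrite mulrAC ler_wpM2r.
Qed.

(** Boundedness makes [sup] a genuine supremum, which is then tested at [x] divided by its norm. *)
Lemma opnormP L : bounded_operator L -> forall x, `|L x| <= opnorm L * `|x|.
Proof.
move=> /linear_boundedP/pinfty_ex_gt0 [M M0 LM] x.
have [->|x0] := eqVneq x 0; first by rewrite linear0 !normr0 mulr0.
have nx0 : 0 < `|x| by rewrite normr_gt0.
rewrite -ler_pdivrMr// mulrC -(ger0_norm (ltW nx0)) -normfV -normrZ -linearZ.
apply: ub_le_sup.
  exists M => _ [y /= y1 <-]; apply: le_trans (LM _) _.
  by rewrite -[leRHS]mulr1 ler_wpM2l// ltW.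
exists (`|x|^-1 *: x) => //=.
by rewrite normrZ normfV normr_id mulVf// gt_eqF.
Qed.

End adjoint.

(** * Maximal monotonicity and Minty's theorem *)

Section maximal_monotonicity.
Context {R : realType} {H : hilbertType R}.
Implicit Types A : H -> set H.

(** A pair monotonically related to the graph can be adjoined to it without losing monotonicity, so
    maximality forces it to be there already. *)
Lemma maximally_monotoneP A : maximally_monotone_op A <->
  monotone_op A /\ forall x u,
    (forall a b, A a b -> 0 <= inner (x - a) (u - b)) -> A x u.
Proof.
split=> -[Amono Amax]; split=> //.
  move=> x u xu; apply: contrapT => nAxu; apply: Amax.
  exists (fun a => [set b | A a b \/ (a = x /\ b = u)]); split.
    move=> x1 x2 u1 u2 /= [A1|[-> ->]] [A2|[-> ->]].
    - exact: Amono.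
    - by rewrite -(opprB x) -(opprB u) innerNl innerNr opprK xu.
    - exact: xu.
    - by rewrite !subrr inner_ge0.
  split; first by move=> p Ap; left.
  by move=> /(_ (x, u)) h; apply: nAxu; apply: h; right.
move=> [A' [A'mono [AA' nA'A]]]; apply: nA'A => -[x u] A'xu.
by apply: Amax => a b Aab; apply: A'mono => //; exact: (AA' (a, b)).
Qed.

Lemma monotone_inv A : monotone_op A -> monotone_op (op_inv A).
Proof. by move=> Amono x1 x2 u1 u2 A1 A2; rewrite innerC; exact: Amono. Qed.

Lemma maximally_monotone_inv A :
  maximally_monotone_op A -> maximally_monotone_op (op_inv A).
Proof.
move=> /maximally_monotoneP[Amono Amax]; apply/maximally_monotoneP; split.
  exact: monotone_inv.
by move=> x u xu; apply: Amax => a b Aab; rewrite innerC; exact: xu.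
Qed.

Lemma minty_zero A : maximally_monotone_op A -> exists x, A x (- x).
Proof.
move=> /maximally_monotoneP[Amono Amax].
(* An empty graph is not maximal: [(0, 0)] is vacuously related to it. *)
have [[a [b Aab]]|noA] := pselect (exists a b, A a b); last first.
  suff A00 : A 0 0 by exfalso; apply: noA; exists 0, 0.
  by apply: Amax => a b Aab; exfalso; apply: noA; exists a, b.
pose phi (p : H * H) (z : H * H * R) :=
  inner p.1 z.1.2 + inner z.1.1 p.2 - inner p.1 p.2 - z.2.
(* [S] is the epigraph of the Fitzpatrick function of [A]. *)
pose S : set (H * H * R) :=
  \bigcap_(p in [set p : H * H | A p.1 p.2]) [set z | phi p z <= 0].
have Sab p q : A p q -> S (p, q, inner p q).
  move=> Apq [c d] /= Acd; rewrite /phi /=.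
  by have := Amono _ _ _ _ Apq Acd; rewrite !innerE; lra.
(* The Fitzpatrick function dominates the duality pairing; this is where maximality first enters. *)
have Slb z : S z -> inner z.1.1 z.1.2 <= z.2.
  move=> Sz; have [|] := pselect (exists c d, A c d /\ inner (z.1.1 - c) (z.1.2 - d) <= 0).
    move=> [c [d [Acd]]]; have := Sz (c, d) Acd.
    by rewrite /phi /= !innerE; lra.
  move=> nz; have Az : A z.1.1 z.1.2.
    apply: Amax => c d Acd; rewrite leNgt; apply/negP => /ltW zcd.
    by apply: nz; exists c, d.
  by have := Sz z.1 Az; rewrite /phi /=; lra.
have Slb0 z : S z -> 0 <= z.2 + (inner z.1.1 z.1.1 + inner z.1.2 z.1.2) / 2.
  move=> /Slb; have := inner_ge0 (z.1.1 + z.1.2).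
  by rewrite !innerE (innerC z.1.2 z.1.1); lra.
have [|||[[x u] t] Sz zmin] := @convex_minimization _ _ _ S 0 _ _ _ Slb0.
- apply: closed_bigI => p _.
  apply: (@closed_comp _ _ (phi p) [set r | r <= 0]) => [z _|]; last exact: closed_le.
  have c1 : z'.1.1 @[z' --> z] --> z.1.1.
    by apply: (cvg_comp _ _ cvg_fst); exact: cvg_fst.
  have c2 : z'.1.2 @[z' --> z] --> z.1.2.
    by apply: (cvg_comp _ _ cvg_fst); exact: cvg_snd.
  apply: cvgB; last exact: cvg_snd.
  apply: cvgB; last exact: cvg_cst.
  by apply: cvgD; apply: cvg_inner => //; exact: cvg_cst.
- by exists (a, b, inner a b); exact: Sab.
- move=> z w s s0 s1 Sz Sw p Ap; have := Sz p Ap; have := Sw p Ap.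
  rewrite /phi /= !innerE /GRing.scale /=.
  move: (inner p.1 p.2) (inner p.1 z.1.2) (inner p.1 w.1.2)
    (inner z.1.1 p.2) (inner w.1.1 p.2) z.2 w.2 => k1 k2 k3 k4 k5 k6 k7.
  by nra.
(* Optimality at [(c, d, inner c d)] combined with [Slb0] at the minimizer. *)
have key c d : A c d -> inner (x + u) (x + u) <= 2 * inner (- u - c) (- x - d).
  move=> /Sab /zmin; have := Slb0 _ Sz; rewrite /= !innerE !(innerC u x) (innerC c x).
  by lra.
have Aux : A (- u) (- x).
  by apply: Amax => c d /key; have := inner_ge0 (x + u); lra.
have /inner_eq0 /eqP : inner (x + u) (x + u) <= 0.
  by apply: le_trans (key _ _ Aux) _; rewrite subrr inner0l mulr0.
by rewrite addr_eq0 => /eqP xu; exists (- u); rewrite -{2}xu.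
Qed.

(** Shifting and rescaling to [A' = (A - w) / r] preserves maximal monotonicity and reduces the
    claim to [minty_zero]. *)
Lemma minty A (r : R) (w : H) : 0 < r -> maximally_monotone_op A ->
  exists x, A x (w - r *: x).
Proof.
move=> r0 /maximally_monotoneP[Amono Amax].
pose A' x := [set u : H | A x (w + r *: u)].
have [|x A'x] := @minty_zero A'; last by exists x; rewrite -scalerN.
apply/maximally_monotoneP; split=> [x1 x2 u1 u2 A1 A2|x u xu].
  have := Amono _ _ _ _ A1 A2.
  by rewrite [w + _]addrC addrKA -scalerBr innerZr pmulr_rge0.
apply: Amax => a b Aab.
have := xu a (r^-1 *: (b - w)).
rewrite /A' /= scalerA divff ?gt_eqF// scale1r addrC subrK => /(_ Aab).
rewrite -(pmulr_rge0 _ r0) -innerZr scalerBr scalerA divff ?gt_eqF// scale1r.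
by rewrite opprB addrA (addrC w).
Qed.

End maximal_monotonicity.

(** * Resolvent compositions *)

Section resolvent_composition.
Context {R : realType} {H G : hilbertType R}.
Context (L : {linear H -> G}).
Context (L_bounded : bounded_operator L) (L_norm : opnorm L <= 1).
Implicit Types (B : G -> set G) (g : R).

Let L_le x : `|L x| <= `|x|.
Proof.
by apply: le_trans (opnormP L L_bounded x) _; rewrite ler_piMl.
Qed.

Let Ladj x y : inner (L x) y = inner x (adjoint L y).
Proof. exact: inner_adjoint _ _ (opnormP L L_bounded) x y. Qed.

Lemma resolvent_compositionE g B x u : resolvent_composition L g B x u <->
  exists2 y, x = adjoint L y & B y (L (u + g^-1 *: x) - g^-1 *: y).
Proof.
split.
  move=> [v [y [b Bb [_ [_ -> <-] e]] <-] [_ [_ -> <-] <-]].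
  by exists y; rewrite // subrK -e addrK.
move=> [y xy By]; exists (u + g^-1 *: x); last first.
  by exists (g^-1 *: x); [exists x|rewrite addrK].
exists y => //; exists (L (u + g^-1 *: x) - g^-1 *: y) => //.
by exists (g^-1 *: y); [exists y|rewrite subrK].
Qed.

Lemma monotone_resolvent_composition g B : 0 < g ->
  monotone_op B -> monotone_op (resolvent_composition L g B).
Proof.
move=> g0 Bmono x1 x2 u1 u2 /resolvent_compositionE[y1 xy1 B1].
move=> /resolvent_compositionE[y2 xy2 B2].
have := Bmono _ _ _ _ B1 B2.
set x := x1 - x2; set y := y1 - y2; set u := u1 - u2.
have adjxy v : inner (L v) y = inner v x.
  by rewrite /x xy1 xy2 !(innerDr, innerNr) !Ladj.
have -> : L (u1 + g^-1 *: x1) - g^-1 *: y1 - (L (u2 + g^-1 *: x2) - g^-1 *: y2) =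
    L (u + g^-1 *: x) - g^-1 *: y.
  by rewrite opprD addrACA -opprD -linearB -scalerBr opprD addrACA -scalerBr.
clearbody x y u.
(* Here [x] is the adjoint image of [y], so [inner (L x) y] equals [inner x x]; expand the square of
   [L x - y]. *)
have yx : inner x x <= inner y y.
  have Lx : inner (L x) (L x) <= inner x x.
    by rewrite !inner_norm ler_pXn2r// nnegrE.
  have := inner_ge0 (L x - y).
  by rewrite !innerE (innerC y (L x)) adjxy; lra.
have := mulr_ge0 (ltW (_ : 0 < g^-1)) (_ : 0 <= inner y y - inner x x).
rewrite invr_gt0 subr_ge0 => /(_ g0 yx).
by rewrite innerC linearD linearZ /= !innerE !adjxy (innerC x u); lra.
Qed.

Lemma maximally_monotone_resolvent_composition g B : 0 < g ->
  maximally_monotone_op B -> maximally_monotone_op (resolvent_composition L g B).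
Proof.
move=> g0 Bmax; have [Bmono _] := Bmax.
have Amono := monotone_resolvent_composition g B g0 Bmono.
apply/maximally_monotoneP; split=> // x u xu.
have gV0 : 0 < g^-1 by rewrite invr_gt0.
have [y By] := minty _ _ (L (u + g^-1 *: x)) gV0 Bmax.
pose x' := adjoint L y.
(* Chosen so that [u' + g^-1 *: x' = u + g^-1 *: x], which puts [(x', u')] in the graph; relatedness
   to this pair then forces [x = x']. *)
pose u' := u + g^-1 *: (x - x').
have A' : resolvent_composition L g B x' u'.
  by apply/resolvent_compositionE; exists y => //; rewrite /u' scalerBr addrA subrK.
have /inner_eq0 /eqP : inner (x - x') (x - x') <= 0.
  have := xu _ _ A'.
  by rewrite /u' opprD addrA subrr sub0r innerNr innerZr oppr_ge0 pmulr_rle0.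
by rewrite subr_eq0 => /eqP xx'; move: A'; rewrite /u' -xx' subrr scaler0 addr0.
Qed.

End resolvent_composition.

Theorem corollary4p5 (R : realType) (H G : hilbertType R)
    (L : {linear H -> G}) (L_bounded : bounded_operator L)
    (L_norm : opnorm L <= 1)
    (B : G -> set G) (B_monotone : monotone_op B)
    (gamma : R) (gamma_gt0 : 0 < gamma) :
  (monotone_op (resolvent_composition L gamma B) /\
   monotone_op (resolvent_cocomposition L gamma B)) /\
  (maximally_monotone_op B ->
   maximally_monotone_op (resolvent_composition L gamma B) /\
   maximally_monotone_op (resolvent_cocomposition L gamma B)).
Proof.
have V0 : 0 < 1 / gamma by rewrite divr_gt0.
split; [split|move=> Bmax; split].
- exact: monotone_resolvent_composition.
- by apply/monotone_inv/monotone_resolvent_composition => //; exact: monotone_inv.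
- exact: maximally_monotone_resolvent_composition.
- apply/maximally_monotone_inv/maximally_monotone_resolvent_composition => //.
  exact: maximally_monotone_inv.
Qed.
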